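(* Let $(G,\tau,\partial)$ be a Polish topometric group with ample generics, let $H$ be a topological group with uniform Souslin number $<2^{\aleph_0}$, and let $\varphi\colon G\to H$ be a group homomorphism that is continuous from $(G,\partial)$ into $H$. Then $\varphi$ is continuous from $(G,\tau)$ into $H$.
   Context: A topometric space is a triple $(X,\tau,\partial)$ where $\tau$ is a topology on $X$ and $\partial$ is a metric on $X$ whose topology refines $\tau$ and which is $\tau$-lower semi-continuous, i.e. $\{(x,y)\colon \partial(x,y)\le r\}$ is closed in $(X,\tau)^2$ for every $r$. A Polish topometric group is a triple $(G,\tau,\partial)$ which is a topometric space such that $(G,\tau)$ is a Polish group and $\partial$ is bi-invariant ($\partial$ need not be separable). For $A\subseteq Y$ in a metric space $(Y,\partial)$ and $\varepsilon>0$, $(A)_\varepsilon=\{y\colon \partial(y,A)<\varepsilon\}$. For each $n$, $G^n$ carries the product topology and the supremum metric $\partial(\bar g,\bar h)=\max_i\partial(g_i,h_i)$, and $G$ acts on $G^n$ by diagonal conjugation $k\cdot(g_0,\dots,g_{n-1})=(kg_0k^{-1},\dots,kg_{n-1}k^{-1})$. The Polish topometric group $(G,\tau,\partial)$ has ample generics if for every $n\in\mathbb N$ and every $\varepsilon>0$ there is $\bar g\in G^n$ such that $(\{k\cdot\bar g\colon k\in G\})_\varepsilon$ is co-meagre in $(G^n,\tau)$. A topological group $H$ has uniform Souslin number $\kappa$ if $\kappa$ is the least cardinal such that for every neighbourhood $V$ of $1_H$, $H$ can be covered by fewer than $\kappa$ left translates of $V$. *)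

(* Defs.v *)
From Stdlib Require Import Reals.
From mathcomp Require Import ssreflect ssrfun ssrbool eqtype ssrnat seq fintype bigop.

Set Implicit Arguments.
Unset Strict Implicit.

Open Scope R_scope.

Definition is_topology (X : Type) (O : (X -> Prop) -> Prop) : Prop :=
  O (fun _ => True) /\
  (forall U V, O U -> O V -> O (fun x => U x /\ V x)) /\
  (forall F : (X -> Prop) -> Prop,
      (forall U, F U -> O U) -> O (fun x => exists U, F U /\ U x)).

Definition prod_open (X Y : Type) (O1 : (X -> Prop) -> Prop)
  (O2 : (Y -> Prop) -> Prop) (W : X * Y -> Prop) : Prop :=
  forall p, W p -> exists U V, O1 U /\ O2 V /\ U p.1 /\ V p.2 /\
    (forall q : X * Y, U q.1 -> V q.2 -> W q).

Definition pow_open (X : Type) (n : nat) (O : (X -> Prop) -> Prop)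
  (W : ('I_n -> X) -> Prop) : Prop :=
  forall g, W g -> exists U : 'I_n -> (X -> Prop),
    (forall i, O (U i)) /\ (forall i, U i (g i)) /\
    (forall h : 'I_n -> X, (forall i, U i (h i)) -> W h).

Definition continuous (X Y : Type) (O1 : (X -> Prop) -> Prop)
  (O2 : (Y -> Prop) -> Prop) (f : X -> Y) : Prop :=
  forall W, O2 W -> O1 (fun x => W (f x)).

Definition closure (X : Type) (O : (X -> Prop) -> Prop) (A : X -> Prop) (x : X) : Prop :=
  forall U, O U -> U x -> exists y, U y /\ A y.

Definition interior (X : Type) (O : (X -> Prop) -> Prop) (A : X -> Prop) (x : X) : Prop :=
  exists U, O U /\ U x /\ (forall y, U y -> A y).

Definition nowhere_dense (X : Type) (O : (X -> Prop) -> Prop) (A : X -> Prop) : Prop :=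
  forall x, ~ interior O (closure O A) x.

Definition meagre (X : Type) (O : (X -> Prop) -> Prop) (A : X -> Prop) : Prop :=
  exists N : nat -> (X -> Prop), (forall k, nowhere_dense O (N k)) /\
    (forall x, A x -> exists k, N k x).

Definition comeagre (X : Type) (O : (X -> Prop) -> Prop) (A : X -> Prop) : Prop :=
  meagre O (fun x => ~ A x).

Definition is_metric (X : Type) (d : X -> X -> R) : Prop :=
  (forall x y, d x y = 0 <-> x = y) /\
  (forall x y, d x y = d y x) /\
  (forall x y z, d x z <= d x y + d y z).

Definition metric_open (X : Type) (d : X -> X -> R) (U : X -> Prop) : Prop :=
  forall x, U x -> exists e, 0 < e /\ forall y, d x y < e -> U y.

Definition cauchy_seq (X : Type) (d : X -> X -> R) (u : nat -> X) : Prop :=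
  forall e, 0 < e -> exists N, forall m n, (N <= m)%nat -> (N <= n)%nat -> d (u m) (u n) < e.

Definition converges (X : Type) (d : X -> X -> R) (u : nat -> X) (x : X) : Prop :=
  forall e, 0 < e -> exists N, forall n, (N <= n)%nat -> d (u n) x < e.

Definition complete_metric (X : Type) (d : X -> X -> R) : Prop :=
  forall u, cauchy_seq d u -> exists x, converges d u x.

(* countable dense subset (the spaces considered below are nonempty groups) *)
Definition separable (X : Type) (O : (X -> Prop) -> Prop) : Prop :=
  exists D : nat -> X, forall U, O U -> (exists x, U x) -> exists k, U (D k).

Definition polish (X : Type) (O : (X -> Prop) -> Prop) : Prop :=
  is_topology O /\ separable O /\
  exists d : X -> X -> R, is_metric d /\ complete_metric d /\
    (forall U, O U <-> metric_open d U).

Definition is_group (X : Type) (mul : X -> X -> X) (inv : X -> X) (one : X) : Prop :=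
  (forall x y z, mul x (mul y z) = mul (mul x y) z) /\
  (forall x, mul one x = x) /\ (forall x, mul x one = x) /\
  (forall x, mul (inv x) x = one) /\ (forall x, mul x (inv x) = one).

Definition topological_group (X : Type) (mul : X -> X -> X) (inv : X -> X) (one : X)
  (O : (X -> Prop) -> Prop) : Prop :=
  is_group mul inv one /\ is_topology O /\
  continuous (prod_open O O) O (fun p : X * X => mul p.1 p.2) /\
  continuous O O inv.

Definition polish_group (X : Type) (mul : X -> X -> X) (inv : X -> X) (one : X)
  (O : (X -> Prop) -> Prop) : Prop :=
  topological_group mul inv one O /\ polish O.

Definition group_hom (X Y : Type) (mulX : X -> X -> X) (mulY : Y -> Y -> Y)
  (f : X -> Y) : Prop :=
  forall x y, f (mulX x y) = mulY (f x) (f y).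

Definition topometric_space (X : Type) (tau : (X -> Prop) -> Prop) (d : X -> X -> R) : Prop :=
  is_topology tau /\ is_metric d /\
  (forall U, tau U -> metric_open d U) /\
  (forall r : R, prod_open tau tau (fun p : X * X => ~ (d p.1 p.2 <= r))).

Definition bi_invariant (X : Type) (mul : X -> X -> X) (d : X -> X -> R) : Prop :=
  forall k x y, d (mul k x) (mul k y) = d x y /\ d (mul x k) (mul y k) = d x y.

Definition polish_topometric_group (X : Type) (mul : X -> X -> X) (inv : X -> X) (one : X)
  (tau : (X -> Prop) -> Prop) (d : X -> X -> R) : Prop :=
  topometric_space tau d /\ polish_group mul inv one tau /\ bi_invariant mul d.

(* (A)_eps = { y | d(y, A) < eps } ; d(y,A) = inf_{a in A} d(y,a) < eps
   iff some a in A has d(y,a) < eps *)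
Definition eps_nbhd (X : Type) (d : X -> X -> R) (A : X -> Prop) (eps : R) (y : X) : Prop :=
  exists a, A a /\ d y a < eps.

Definition sup_metric (X : Type) (n : nat) (d : X -> X -> R) (g h : 'I_n -> X) : R :=
  \big[Rmax/0]_(i < n) d (g i) (h i).

Definition diag_conj (X : Type) (n : nat) (mul : X -> X -> X) (inv : X -> X)
  (k : X) (g : 'I_n -> X) : 'I_n -> X :=
  fun i => mul (mul k (g i)) (inv k).

Definition orbit (X : Type) (n : nat) (mul : X -> X -> X) (inv : X -> X)
  (g : 'I_n -> X) (h : 'I_n -> X) : Prop :=
  exists k, h = diag_conj mul inv k g.

Definition ample_generics (X : Type) (mul : X -> X -> X) (inv : X -> X)
  (tau : (X -> Prop) -> Prop) (d : X -> X -> R) : Prop :=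
  forall (n : nat) (eps : R), 0 < eps ->
    exists g : 'I_n -> X,
      comeagre (@pow_open X n tau) (eps_nbhd (@sup_metric X n d) (orbit mul inv g) eps).

Definition card_le (X Y : Type) (A : X -> Prop) (B : Y -> Prop) : Prop :=
  exists f : X -> Y, (forall x, A x -> B (f x)) /\
    (forall x y, A x -> A y -> f x = f y -> x = y).

Definition card_lt (X Y : Type) (A : X -> Prop) (B : Y -> Prop) : Prop :=
  card_le A B /\ ~ card_le B A.

Definition neighbourhood (X : Type) (O : (X -> Prop) -> Prop) (V : X -> Prop) (x : X) : Prop :=
  exists U, O U /\ U x /\ (forall y, U y -> V y).

Definition covered_by_left_translates (X : Type) (mul : X -> X -> X)
  (A : X -> Prop) (V : X -> Prop) : Prop :=
  forall x, exists a v, A a /\ V v /\ x = mul a v.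

(* "uniform Souslin number < 2^aleph_0": there is a cardinal lambda < 2^aleph_0
   (represented by a subset S of nat -> bool with |S| < |nat -> bool|) such that
   for every neighbourhood V of 1, X is covered by fewer than lambda left
   translates of V.  The least such lambda is the uniform Souslin number. *)
Definition usouslin_lt_continuum (X : Type) (mul : X -> X -> X) (one : X)
  (O : (X -> Prop) -> Prop) : Prop :=
  exists S : (nat -> bool) -> Prop,
    card_lt S (fun _ : nat -> bool => True) /\
    forall V, neighbourhood O V one ->
      exists A : X -> Prop, covered_by_left_translates mul A V /\ card_lt A S.

(* Main.v *)
(* Suppose [phi] is discontinuous at 1 and let [W] be a neighbourhood of 1 whose
   preimage is not a neighbourhood of 1. Fix a symmetric [V] with [V^8] inside [W],
   and let [A] be the preimage of [V].

   By Mycielski's theorem a meagre [M] admits a family (h_a), a in 2^N, with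
   h_a^-1 h_b outside [M] for a <> b; since fewer than 2^aleph_0 translates of a
   small neighbourhood cover [H], the preimage [A] of [V] is not meagre.

   Ample generics then give a Cantor tree: node s carries a tuple x of G, all of whose
   generic extensions remain generic, and some h in G. An Effros-type argument
   produces two generic extensions y0, y1 of x, an f close to 1 and a g with phi(g)
   outside [W], such that y0 is in gA, y1 is in A, f y1 f^-1 is d-close to y0 and f
   d-almost commutes with the entries of x. The two children carry h and h f.
   Along branches these h converge to h_a, and if a and b split at s then
   h_a y0 h_a^-1 is d-close to h_b y1 h_b^-1. By the pigeonhole principle some a <> b
   have phi(h_a^-1 h_b) in [V]; as the preimage of [V] is also a d-neighbourhood
   of 1, phi(g) lies in V^5, a contradiction. *)

From Stdlib Require Import Reals Lra Classical ClassicalEpsilon FunctionalExtensionality PropExtensionality.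
From mathcomp Require Import ssreflect ssrfun ssrbool eqtype ssrnat seq choice fintype tuple bigop.
Require Import Defs.

Set Implicit Arguments.
Unset Strict Implicit.

Local Open Scope R_scope.

Lemma choice_fun (X Y : Type) (P : X -> Y -> Prop) :
  (forall x, exists y, P x y) -> exists f : X -> Y, forall x, P x (f x).
Proof.
move=> PH; exists (fun x => proj1_sig (constructive_indefinite_description _ (PH x))).
by move=> x; case: constructive_indefinite_description.
Qed.

(** * Baire category *)

Section Category.

Variables (X : Type) (O : (X -> Prop) -> Prop).

Lemma nowhere_dense_sub (A B : X -> Prop) :
  (forall x, A x -> B x) -> nowhere_dense O B -> nowhere_dense O A.
Proof.
move=> AB nB x [U [OU [Ux UA]]]; apply: (nB x); exists U; split=> //; split=> // y Uy W OW Wy.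
by have [z [Wz Az]] := UA y Uy W OW Wy; exists z; split=> //; apply: AB.
Qed.

Lemma nowhere_dense_empty : nowhere_dense O (fun _ => False).
Proof. by move=> x [U [OU [Ux UA]]]; have [y []] := UA x Ux U OU Ux. Qed.

Lemma nowhere_dense_meagre (A : X -> Prop) : nowhere_dense O A -> meagre O A.
Proof. by move=> nA; exists (fun _ => A); split=> // x Ax; exists 0%N. Qed.

Lemma meagre_sub (A B : X -> Prop) :
  (forall x, A x -> B x) -> meagre O B -> meagre O A.
Proof. by move=> AB [N [nN BN]]; exists N; split=> // x /AB/BN. Qed.

Lemma meagre_bigcup (A : nat -> X -> Prop) :
  (forall n, meagre O (A n)) -> meagre O (fun x => exists n, A n x).
Proof.
move=> /choice_fun [N NP].
(* Codes that decode to no pair get the empty set, which is nowhere dense. *)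
exists (fun k => if (unpickle k : option (nat * nat)) is Some p then N p.1 p.2 else fun _ => False).
split=> [k|x [n Anx]].
  by case: unpickle => [[i j]|] /=; [case: (NP i) | exact: nowhere_dense_empty].
by have [_ /(_ x Anx) [k Nk]] := NP n; exists (pickle (n, k)); rewrite pickleK.
Qed.

Lemma meagre_bigcup_count (I : countType) (A : I -> X -> Prop) :
  (forall i, meagre O (A i)) -> meagre O (fun x => exists i, A i x).
Proof.
move=> mA; apply: (meagre_sub (B := fun x => exists n,
  (if (unpickle n : option I) is Some i then A i else fun _ => False) x)).
  by move=> x [i Ai]; exists (pickle i); rewrite pickleK.
apply: meagre_bigcup => n; case: unpickle => [i|] //.
exact/nowhere_dense_meagre/nowhere_dense_empty.
Qed.

Lemma meagreU (A B : X -> Prop) :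
  meagre O A -> meagre O B -> meagre O (fun x => A x \/ B x).
Proof.
move=> mA mB; apply: (meagre_sub (B := fun x => exists b : bool, (if b then A else B) x)).
  by move=> x [Ax|Bx]; [exists true | exists false].
by apply: meagre_bigcup_count; case.
Qed.

Lemma comeagre_sub (A B : X -> Prop) :
  (forall x, A x -> B x) -> comeagre O A -> comeagre O B.
Proof. by move=> AB; apply: meagre_sub => x nB /AB. Qed.

Lemma comeagreI (A B : X -> Prop) :
  comeagre O A -> comeagre O B -> comeagre O (fun x => A x /\ B x).
Proof.
move=> cA cB; apply: (meagre_sub _ (meagreU cA cB)) => x nAB.
by case: (classic (A x)) => Ax; [right=> Bx; apply: nAB | left].
Qed.

Lemma comeagre_bigcap (A : nat -> X -> Prop) :
  (forall n, comeagre O (A n)) -> comeagre O (fun x => forall n, A n x).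
Proof.
move=> /meagre_bigcup; apply: meagre_sub => x nA.
by apply: NNPP => nE; apply: nA => n; apply: NNPP => nAn; apply: nE; exists n.
Qed.

Lemma nonmeagre_meets_comeagre (A B : X -> Prop) :
  ~ meagre O A -> comeagre O B -> exists x, A x /\ B x.
Proof.
move=> nA cB; apply: NNPP => nE; apply: nA.
by apply: meagre_sub cB => x Ax Bx; apply: nE; exists x.
Qed.

Lemma meagre_homeo (f g : X -> X) (A : X -> Prop) :
  cancel f g -> cancel g f -> continuous O O f -> continuous O O g ->
  meagre O A -> meagre O (fun x => A (f x)).
Proof.
move=> fK gK cf cg [N [nN AN]]; exists (fun k x => N k (f x)).
split=> [k x [U [OU [Ux Ucl]]]|x /AN //].
apply: (nN k (f x)); exists (fun y => U (g y)); split; first exact: cg.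
split=> [|y Ugy W OW Wy]; first by rewrite fK.
have [z [Wz Nz]] := Ucl (g y) Ugy _ (cf W OW) (ltac:(rewrite /= gK; exact: Wy)).
by exists (f z).
Qed.

Hypothesis topO : is_topology O.

Lemma open_local (A : X -> Prop) :
  (forall x, A x -> exists U, O U /\ U x /\ forall y, U y -> A y) -> O A.
Proof.
move=> loc; case: topO => _ [_ OU].
rewrite (_ : A = fun x => exists U, (O U /\ forall y, U y -> A y) /\ U x).
  by apply: OU => U [].
apply: functional_extensionality => x; apply: propositional_extensionality.
by split=> [/loc [U [? []]]|[U [[_ UA] /UA]]] //; exists U.
Qed.

Lemma openI (U V : X -> Prop) : O U -> O V -> O (fun x => U x /\ V x).
Proof. by case: topO => _ [OI _]; apply: OI. Qed.

Lemma openT : O (fun _ => True).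
Proof. by case: topO. Qed.

Lemma interior_open (A : X -> Prop) : O (interior O A).
Proof.
apply: open_local => x [U [OU [Ux UA]]]; exists U; split=> //; split=> // y Uy.
by exists U.
Qed.

(** This is Kuratowski's set D(A), which is closed. It stands in for the Baire property: off a
    meagre set, points of [A] lie in its interior. *)
Definition nonmeagre_at (A : X -> Prop) (x : X) : Prop :=
  forall U, O U -> U x -> ~ meagre O (fun y => A y /\ U y).

Lemma nonmeagre_at_closed (A : X -> Prop) x :
  closure O (nonmeagre_at A) x -> nonmeagre_at A x.
Proof. by move=> clx U OU Ux; have [y [Uy]] := clx U OU Ux; apply. Qed.

Lemma nonmeagre_at_closure (A : X -> Prop) x : nonmeagre_at A x -> closure O A x.
Proof.
move=> Dx U OU Ux; apply: NNPP => nE; apply: (Dx U OU Ux).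
apply: (meagre_sub (B := fun _ => False)); last exact/nowhere_dense_meagre/nowhere_dense_empty.
by move=> y [Ay Uy]; apply: nE; exists y.
Qed.

Lemma closed_frontier_nowhere_dense (C : X -> Prop) :
  (forall x, closure O C x -> C x) -> nowhere_dense O (fun x => C x /\ ~ interior O C x).
Proof.
move=> Ccl x [U [OU [Ux Ucl]]].
have [y [Uy [_ nI]]] := Ucl x Ux U OU Ux; apply: nI; exists U; split=> //; split=> // z Uz.
by apply: Ccl => W OW Wz; have [t [Wt [Ct _]]] := Ucl z Uz W OW Wz; exists t.
Qed.

Lemma open_frontier_nowhere_dense (W : X -> Prop) :
  O W -> nowhere_dense O (fun x => closure O W x /\ ~ W x).
Proof.
move=> OW x [U [OU [Ux Ucl]]].
have [y [Uy [clW nW]]] := Ucl x Ux U OU Ux.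
have [z [Uz Wz]] := clW U OU Uy.
by have [t [Wt [_ nWt]]] := Ucl z Uz W OW Wz.
Qed.

Variable B : nat -> X -> Prop.
Hypothesis Bbase : forall U x, O U -> U x -> exists j, B j x /\ forall y, B j y -> U y.

(** Banach category theorem for a countable base: an exceptional point lies in a basic set that [A]
    meets in a meagre set, and there are countably many such sets. *)
Lemma meagre_not_nonmeagre_at (A : X -> Prop) :
  meagre O (fun x => A x /\ ~ nonmeagre_at A x).
Proof.
apply: (meagre_sub (B := fun x => exists j,
   (A x /\ B j x) /\ meagre O (fun y => A y /\ B j y))).
  move=> x [Ax nD]; apply: NNPP => nE; apply: nD => U OU Ux mU.
  have [j [Bx BU]] := Bbase OU Ux; apply: nE; exists j; split=> //.
  by apply: meagre_sub mU => y [Ay /BU].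
apply: meagre_bigcup => j.
case: (classic (meagre O (fun y => A y /\ B j y))) => mj.
  by apply: meagre_sub mj => x [].
by apply: meagre_sub (nowhere_dense_meagre nowhere_dense_empty) => x [].
Qed.

Lemma meagre_not_interior_nonmeagre_at (A : X -> Prop) :
  meagre O (fun x => A x /\ ~ interior O (nonmeagre_at A) x).
Proof.
apply: (meagre_sub _ (meagreU (meagre_not_nonmeagre_at A)
  (nowhere_dense_meagre (closed_frontier_nowhere_dense (@nonmeagre_at_closed A))))).
by move=> x [Ax nI]; case: (classic (nonmeagre_at A x)) => Dx; [right | left].
Qed.

(** The exceptional set lies in the frontier of the open set [W]: an open set missing [W] meets
    every [F i], hence [E], in a meagre set. *)
Lemma nonmeagre_at_split (I : countType) (E : X -> Prop) (F : I -> X -> Prop) :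
  (forall x, E x -> exists i, F i x) ->
  nowhere_dense O (fun x => nonmeagre_at E x /\
                     ~ exists i, interior O (nonmeagre_at (F i)) x).
Proof.
move=> EF; set W := fun x => exists i, interior O (nonmeagre_at (F i)) x.
have OW : O W.
  apply: open_local => x [i Ix]; exists (interior O (nonmeagre_at (F i))).
  by split; [exact: interior_open | split=> // y Iy; exists i].
apply: nowhere_dense_sub (open_frontier_nowhere_dense OW) => x [Dx nW]; split=> // U OU Ux.
apply: NNPP => nE; apply: (Dx U OU Ux).
apply: (meagre_sub _ (meagre_bigcup_count (fun i => meagre_not_interior_nonmeagre_at (F i)))).
move=> y [/EF [i Fy] Uy]; exists i; split=> // Iy; apply: nE; exists y; split=> //; by exists i.
Qed.

End Category.

(** * Powers of one half *)

Definition half_pow (n : nat) : R := (/ 2) ^ n.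

Lemma half_pow_gt0 n : 0 < half_pow n.
Proof. by apply: pow_lt; lra. Qed.

Lemma half_powS n : half_pow n.+1 = half_pow n / 2.
Proof. by rewrite /half_pow /=; lra. Qed.

Lemma half_pow_le1 n : half_pow n <= 1.
Proof.
elim: n => [|n IH]; first by rewrite /half_pow /=; lra.
by rewrite half_powS; have := half_pow_gt0 n; lra.
Qed.

Lemma half_pow_small e : 0 < e -> exists N, forall n, (N <= n)%N -> half_pow n < e.
Proof.
move=> e0; have [N NP] := pow_lt_1_zero (/ 2) (ltac:(rewrite Rabs_pos_eq; lra)) e e0.
exists N => n /leP /NP; rewrite Rabs_pos_eq //; exact/Rlt_le/half_pow_gt0.
Qed.

(** * Polish spaces and projections of closed sets *)

Section Metric.

Variables (X : Type) (rho : X -> X -> R).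
Hypothesis metric_rho : is_metric rho.

Lemma metric_refl x : rho x x = 0.
Proof. by case: metric_rho => [/(_ x x) [_ ->]]. Qed.

Lemma metric_sym x y : rho x y = rho y x.
Proof. by case: metric_rho => [_ []]. Qed.

Lemma metric_tri x y z : rho x z <= rho x y + rho y z.
Proof. by case: metric_rho => [_ []]. Qed.

Lemma ball_open x e : metric_open rho (fun y => rho x y < e).
Proof.
move=> y xy; exists (e - rho x y); split; first lra.
by move=> z yz; have := metric_tri x y z; lra.
Qed.

Lemma converges_closed_ball u x c r :
  converges rho u x -> (exists N, forall n, (N <= n)%N -> rho c (u n) <= r) -> rho c x <= r.
Proof.
move=> ux [N uN]; case: (Rle_or_lt (rho c x) r) => // lt.
have [M uM] := ux (rho c x - r) (ltac:(lra)).
have := uN _ (leq_maxl N M); have := uM _ (leq_maxr N M).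
have := metric_tri c (u (maxn N M)) x; lra.
Qed.

Lemma half_pow_cauchy u :
  (forall n, rho (u n) (u n.+1) <= half_pow n) -> cauchy_seq rho u.
Proof.
move=> uS; have tail m n : (m <= n)%N -> rho (u m) (u n) <= 2 * half_pow m - 2 * half_pow n.
  elim: n => [|n IH]; first by rewrite leqn0 => /eqP ->; rewrite metric_refl; lra.
  rewrite leq_eqVlt => /orP [/eqP ->|]; first by rewrite metric_refl; lra.
  move=> /IH; rewrite half_powS; have := metric_tri (u m) (u n) (u n.+1).
  by have := uS n; lra.
move=> e e0; have [N NP] := half_pow_small (ltac:(lra) : 0 < e / 4).
exists N => m n Nm Nn; have := tail N m Nm; have := tail N n Nn.
have := metric_tri (u m) (u N) (u n); rewrite (metric_sym (u m) (u N)).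
by have := half_pow_gt0 m; have := half_pow_gt0 n; have := NP N (leqnn N); lra.
Qed.

End Metric.

Section Polish.

Variables (X : Type) (O : (X -> Prop) -> Prop) (rho : X -> X -> R) (D : nat -> X).
Hypotheses (topO : is_topology O) (metric_rho : is_metric rho)
  (rho_complete : complete_metric rho)
  (openE : forall U, O U <-> metric_open rho U)
  (Ddense : forall U, O U -> (exists x, U x) -> exists k, U (D k)).

Lemma dense_approx x e : 0 < e -> exists k, rho (D k) x < e.
Proof.
move=> e0; have [//||k xk] := Ddense (U := fun y => rho x y < e).
- exact/openE/ball_open.
- by exists x; rewrite metric_refl.
- by exists k; rewrite metric_sym.
Qed.

Lemma polish_base : exists B : nat -> X -> Prop, (forall j, O (B j)) /\
  forall U x, O U -> U x -> exists j, B j x /\ forall y, B j y -> U y.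
Proof.
exists (fun j => if (unpickle j : option (nat * nat)) is Some p
                 then fun y => rho (D p.1) y < half_pow p.2 else fun _ => True).
split=> [j|U x OU Ux].
  by case: unpickle => [p|]; [exact/openE/ball_open | exact: openT].
have /openE/(_ x Ux) [e [e0 Ue]] := OU.
have [m mP] := half_pow_small (ltac:(lra) : 0 < e / 2).
have [k kx] := dense_approx x (half_pow_gt0 m).
exists (pickle (k, m)); rewrite pickleK /=; split=> // y ky; apply: Ue.
have := metric_tri metric_rho x (D k) y; rewrite (metric_sym metric_rho x (D k)).
by have := mP m (leqnn m); lra.
Qed.

(** The [U n] need not be closed: the closed ball squeezed between [U n.+1] and [U n] keeps the
    limit inside. *)
Lemma nested_balls (U : nat -> X -> Prop) :
  (forall n, exists x, U n x) ->
  (forall n, exists p r, r <= half_pow n /\ (forall x, U n.+1 x -> rho p x <= r) /\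
                         forall x, rho p x <= r -> U n x) ->
  exists x, forall n, U n x.
Proof.
move=> /choice_fun [u uP] /choice_fun [p /choice_fun [r rP]].
have Ur n x : U n.+1 x -> rho (p n) x <= r n by have [_ []] := rP n; auto.
have rU n x : rho (p n) x <= r n -> U n x by have [_ []] := rP n; auto.
have subN m n x : (m <= n)%N -> U n x -> U m x.
  by move/subnK => <-; elim: (n - m)%N => [//|k IH]; rewrite addSn => /Ur/rU.
have close n x y : U n.+1 x -> U n.+1 y -> rho x y <= 2 * half_pow n.
  move=> /Ur px /Ur py; have := metric_tri metric_rho x (p n) y; have [rn _] := rP n.
  by rewrite (metric_sym metric_rho x (p n)); lra.
have [|x ux] := rho_complete (u := u).
  move=> e e0; have [N NP] := half_pow_small (ltac:(lra) : 0 < e / 2).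
  exists N.+1 => m n Nm Nn; have := close N (u m) (u n).
  by have := NP N (leqnn N) => ? /(_ (subN _ _ _ Nm (uP m)) (subN _ _ _ Nn (uP n))); lra.
exists x => n; apply: rU; apply: (converges_closed_ball metric_rho ux).
by exists n.+1 => m nm; apply: Ur; apply: subN (uP m).
Qed.

(** Words are read backwards: the head is the latest index and [size s'] its level. A cell is a
    finite intersection of closed balls centred in the dense sequence. *)
Fixpoint cell (s : seq nat) (z : X) : Prop :=
  if s is k :: s' then rho (D k) z <= half_pow (size s') /\ cell s' z else True.

(* The projection [E] of the closed set [F] is analytic, and this is the part of
   its Baire property that is needed. Off a meagre set, non-meagreness of [E] at
   [x] persists along a branch of the Souslin scheme [cell]; completeness makes
   the branch converge, and the limit is a witness for [x] since [F] is closed. *)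
Lemma nonmeagre_at_projection (F : X -> X -> Prop) :
  (forall z x, ~ F z x -> exists U V, O U /\ O V /\ U z /\ V x /\
     forall z' x', U z' -> V x' -> ~ F z' x') ->
  meagre O (fun x => nonmeagre_at O (fun y => exists z, F z y) x /\ ~ exists z, F z x).
Proof.
move=> Fclosed; have [B [_ Bbase]] := polish_base.
pose E s x := exists z, cell s z /\ F z x.
have Esplit s x : E s x -> exists k, E (k :: s) x.
  move=> [z [Cz Fz]]; have [k kz] := dense_approx z (half_pow_gt0 (size s)).
  by exists k, z; do 2!split=> //; lra.
apply: (meagre_sub (B := fun x => exists s, nonmeagre_at O (E s) x /\
    ~ exists k, interior O (nonmeagre_at O (E (k :: s))) x)); last first.
  apply: meagre_bigcup_count => s; apply: nowhere_dense_meagre.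
  exact: (nonmeagre_at_split (I := nat) (F := fun k => E (k :: s)) topO Bbase (Esplit s)).
move=> x [Dx nF]; apply: NNPP => nS; apply: nF.
(* [nS] says that [x] is exceptional at no node, so non-meagreness passes to some child; at the
   other nodes index 0 is a dummy. *)
have next s : exists k, nonmeagre_at O (E s) x -> nonmeagre_at O (E (k :: s)) x.
  case: (classic (nonmeagre_at O (E s) x)) => Ds; last by exists 0%N.
  apply: NNPP => nk; apply: nS; exists s; split=> // -[k [U [OU [Ux UD]]]].
  by apply: nk; exists k => _; apply: UD.
have [nx nxP] := choice_fun next.
pose br := fix br n := if n is m.+1 then nx (br m) :: br m else [::].
have sbr n : size (br n) = n by elim: n => //= n ->.
have Dbr n : nonmeagre_at O (E (br n)) x.
  elim: n => [|n IH]; last exact: nxP.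
  move=> U OU Ux mU; apply: (Dx U OU Ux).
  by apply: meagre_sub mU => y [[z Fz] Uy]; split=> //; exists z.
pose u n := D (nx (br n)).
have cellP n z : cell (br n) z -> forall i, (i < n)%N -> rho (u i) z <= half_pow i.
  elim: n => [//|n IH] /= [rz Cz] i; rewrite ltnS leq_eqVlt => /orP [/eqP ->|].
    by move: rz; rewrite sbr.
  exact: IH.
have Ebr n V : O V -> V x -> exists y, V y /\ E (br n) y.
  exact: nonmeagre_at_closure (Dbr n) V.
have [|z uz] := rho_complete (u := u).
  move=> e e0; have [N NP] := half_pow_small (ltac:(lra) : 0 < e / 2).
  exists N => m n Nm Nn.
  have [y [_ [z [Cz _]]]] := Ebr (maxn m n).+1 _ (openT topO) I.
  have := cellP _ _ Cz m (leq_maxl m n); have := cellP _ _ Cz n (leq_maxr m n).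
  have := metric_tri metric_rho (u m) z (u n); rewrite (metric_sym metric_rho z).
  by have := NP m Nm; have := NP n Nn; lra.
(* Otherwise a box around [(z, x)] misses [F]; but [E (br n)] always meets its second side, and for
   large [n] the witnesses, lying in deep cells, fall in its first. *)
exists z; apply: NNPP => /Fclosed [U [V [OU [OV [Uz [Vx UVF]]]]]].
have /openE/(_ z Uz) [e [e0 Ue]] := OU.
have [N NP] := half_pow_small (ltac:(lra) : 0 < e / 2).
have [M MP] := uz (e / 2) (ltac:(lra)).
have [y [Vy [z' [Cz' Fz']]]] := Ebr (maxn M N).+1 V OV Vx.
apply: UVF Vy Fz'; apply: Ue.
have := cellP _ _ Cz' _ (ltnSn _); have := NP _ (leq_maxr M N); have := MP _ (leq_maxl M N).
by have := metric_tri metric_rho z (u (maxn M N)) z'; rewrite (metric_sym metric_rho z (u _)); lra.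
Qed.

End Polish.

(** * Category in finite powers *)

Section PowerCategory.

Variables (X : Type) (O : (X -> Prop) -> Prop).

Definition pcons n (y : X) (x : 'I_n -> X) : 'I_n.+1 -> X :=
  fun i => if unlift ord0 i is Some j then x j else y.

Lemma pcons0 n y (x : 'I_n -> X) : pcons y x ord0 = y.
Proof. by rewrite /pcons unlift_none. Qed.

Lemma pconsS n y (x : 'I_n -> X) j : pcons y x (lift ord0 j) = x j.
Proof. by rewrite /pcons liftK. Qed.

Lemma pcons_eta n (z : 'I_n.+1 -> X) : z = pcons (z ord0) (fun j => z (lift ord0 j)).
Proof.
apply: functional_extensionality => i.
by case: (unliftP ord0 i) => [j|] ->; rewrite ?pcons0 ?pconsS.
Qed.

Lemma pcons_open n (W : ('I_n.+1 -> X) -> Prop) y x :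
  pow_open O W -> W (pcons y x) ->
  exists U V, pow_open O U /\ O V /\ U x /\ V y /\
    forall x' y', U x' -> V y' -> W (pcons y' x').
Proof.
move=> OW /OW [U [OU [Uyx UW]]].
exists (fun x' => forall j, U (lift ord0 j) (x' j)), (U ord0).
split; first by move=> x' Ux'; exists (fun j => U (lift ord0 j)).
split=> //; split; first by move=> j; have := Uyx (lift ord0 j); rewrite pconsS.
split; first by have := Uyx ord0; rewrite pcons0.
move=> x' y' Ux' Uy'; apply: UW => i.
by case: (unliftP ord0 i) => [j|] ->; rewrite ?pcons0 ?pconsS.
Qed.

Lemma pow_open_box n (U : ('I_n -> X) -> Prop) (V : X -> Prop) :
  pow_open O U -> O V ->
  pow_open O (fun z : 'I_n.+1 -> X => V (z ord0) /\ U (fun j => z (lift ord0 j))).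
Proof.
move=> OU OV z [Vz /OU [U' [OU' [Uz U'U]]]].
exists (fun i => if unlift ord0 i is Some j then U' j else V); split.
  by move=> i; case: unlift.
split=> [i|h hU].
  by case: (unliftP ord0 i) => [j|] ->; rewrite ?liftK ?unlift_none.
split; first by have := hU ord0; rewrite unlift_none.
by apply: U'U => j; have := hU (lift ord0 j); rewrite liftK.
Qed.

Variable B : nat -> X -> Prop.
Hypothesis Bopen : forall j, O (B j).
Hypothesis Bbase : forall U x, O U -> U x -> exists j, B j x /\ forall y, B j y -> U y.

(** If a section of a nowhere dense [N k] is somewhere dense, its closure contains a nonempty basic
    [B j]. For fixed [k] and [j] such [x] form a nowhere dense set, since otherwise the closure of
    [N k] would contain a box. *)
Lemma kuratowski_ulam n (P : ('I_n.+1 -> X) -> Prop) :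
  comeagre (@pow_open X n.+1 O) P ->
  comeagre (@pow_open X n O) (fun x => comeagre O (fun y => P (pcons y x))).
Proof.
move=> [N [nN PN]].
pose bad k j x := (exists y, B j y) /\
  forall y, B j y -> closure (@pow_open X n.+1 O) (N k) (pcons y x).
apply: (meagre_sub (B := fun x => exists kj : nat * nat, bad kj.1 kj.2 x)).
  move=> x nc; apply: NNPP => nbad; apply: nc.
  exists (fun k y => N k (pcons y x)); split=> [k y [U [OU [Uy Ucl]]]|y /PN //].
  have [j [By BU]] := Bbase OU Uy; apply: nbad; exists (k, j); split; first by exists y.
  move=> y' /BU Uy' W OW /(pcons_open OW) [V [V' [_ [OV' [Vx [V'y VW]]]]]].
  have [z [V'z Nz]] := Ucl _ Uy' V' OV' V'y.
  by exists (pcons z x); split=> //; apply: VW.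
apply: meagre_bigcup_count => -[k j] /=; apply: nowhere_dense_meagre.
move=> x [U [OU [Ux Ucl]]].
have [_ [_ [[y By] _]]] := Ucl x Ux U OU Ux.
apply: (nN k (pcons y x)).
exists (fun z => B j (z ord0) /\ U (fun i => z (lift ord0 i))).
split; first exact: pow_open_box.
split.
  rewrite pcons0; split=> //; rewrite (_ : (fun i => _) = x) //.
  by apply: functional_extensionality => i; rewrite pconsS.
move=> z [Bz Uz] W OW; rewrite [z in W z]pcons_eta => /(pcons_open OW).
move=> [V [V' [OV [OV' [Vz [V'z VW]]]]]].
have [x' [Vx' [_ cl]]] := Ucl _ Uz V OV Vz.
by apply: (cl _ Bz W OW); apply: VW.
Qed.

(** Coordinates are peeled off by [kuratowski_ulam]; the zeroth power is a single point, whose only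
    nowhere dense subset is empty. *)
Lemma comeagre_pow_nonempty n (P : ('I_n -> X) -> Prop) :
  ~ meagre O (fun _ => True) -> comeagre (@pow_open X n O) P -> exists x, P x.
Proof.
move=> nX; elim: n P => [|n IH] P.
  move=> [N [nN PN]].
  pose x0 : 'I_0 -> X := fun i => match notF (ltn_ord i) with end.
  have x0E (x : 'I_0 -> X) : x = x0 by apply: functional_extensionality => -[].
  exists x0; apply: NNPP => /PN [k Nk]; apply: (nN k x0); exists (fun _ => True).
  split; first by move=> g _; exists (fun _ _ => True); split=> // -[].
  by split=> // y _ W OW Wy; exists y; rewrite (x0E y) in Wy *.
move=> /kuratowski_ulam/IH [x /(nonmeagre_meets_comeagre nX) [y [_ Py]]].
by exists (pcons y x).
Qed.

End PowerCategory.

Lemma sup_metric_ge (X : Type) (d : X -> X -> R) n (g h : 'I_n -> X) i :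
  d (g i) (h i) <= sup_metric d g h.
Proof.
rewrite /sup_metric; have := mem_index_enum i; elim: (index_enum _) => // j r IH.
rewrite inE big_cons => /orP [/eqP ->|/IH]; first exact: Rmax_l.
by move=> le; apply: Rle_trans le (Rmax_r _ _).
Qed.

(** * Topological groups *)

Section GroupAlgebra.

Variables (G : Type) (mul : G -> G -> G) (inv : G -> G) (one : G).
Hypothesis groupG : is_group mul inv one.

Lemma gmulA x y z : mul x (mul y z) = mul (mul x y) z.
Proof. by case: groupG. Qed.
Lemma gmul1 x : mul one x = x.
Proof. by case: groupG => _ []. Qed.
Lemma gmulx1 x : mul x one = x.
Proof. by case: groupG => _ [_ []]. Qed.
Lemma gmulV x : mul (inv x) x = one.
Proof. by case: groupG => _ [_ [_ []]]. Qed.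
Lemma gmulxV x : mul x (inv x) = one.
Proof. by case: groupG => _ [_ [_ []]]. Qed.
Lemma gmulK x : cancel (mul x) (mul (inv x)).
Proof. by move=> y; rewrite gmulA gmulV gmul1. Qed.
Lemma gmulKV x : cancel (mul (inv x)) (mul x).
Proof. by move=> y; rewrite gmulA gmulxV gmul1. Qed.
Lemma ginv_unique x y : mul x y = one -> y = inv x.
Proof. by move=> xy; rewrite -(gmulK x y) xy gmulx1. Qed.
Lemma ginvK x : inv (inv x) = x.
Proof. by symmetry; apply: ginv_unique; rewrite gmulV. Qed.
Lemma ginvM x y : inv (mul x y) = mul (inv y) (inv x).
Proof. by symmetry; apply: ginv_unique; rewrite -gmulA gmulKV gmulxV. Qed.
Lemma ginv1 : inv one = one.
Proof. by rewrite -[LHS]gmul1 gmulxV. Qed.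

Definition conj k x := mul (mul k x) (inv k).

Lemma conjM k l x : conj (mul k l) x = conj k (conj l x).
Proof. by rewrite /conj ginvM !gmulA. Qed.
Lemma conj1 x : conj one x = x.
Proof. by rewrite /conj ginv1 gmulx1 gmul1. Qed.
Lemma conjK k : cancel (conj k) (conj (inv k)).
Proof. by move=> x; rewrite -conjM gmulV conj1. Qed.
Lemma conjKV k : cancel (conj (inv k)) (conj k).
Proof. by move=> x; rewrite -conjM gmulxV conj1. Qed.

End GroupAlgebra.

Section TopologicalGroup.

Variables (G : Type) (mul : G -> G -> G) (inv : G -> G) (one : G)
  (tau : (G -> Prop) -> Prop).
Hypothesis topG : topological_group mul inv one tau.

Let groupG : is_group mul inv one := proj1 topG.
Let topo : is_topology tau := proj1 (proj2 topG).

Local Notation conj := (conj mul inv).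

Lemma mul_open W x y : tau W -> W (mul x y) ->
  exists U V, tau U /\ tau V /\ U x /\ V y /\ forall x' y', U x' -> V y' -> W (mul x' y').
Proof.
move=> tW Wxy; have [_ [_ [cm _]]] := topG.
have [U [V [tU [tV [Ux [Vy UVW]]]]]] := cm W tW (x, y) Wxy.
by exists U, V; do 4!split=> //; move=> x' y'; apply: (UVW (x', y')).
Qed.

Lemma inv_continuous : continuous tau tau inv.
Proof. by have [_ [_ []]] := topG. Qed.

Lemma conj_open W k x : tau W -> W (conj k x) ->
  exists U V, tau U /\ tau V /\ U k /\ V x /\ forall k' x', U k' -> V x' -> W (conj k' x').
Proof.
move=> tW /(mul_open tW) [U1 [V1 [tU1 [tV1 [U1x [V1x UV1]]]]]].
have [U2 [V2 [tU2 [tV2 [U2x [V2x UV2]]]]]] := mul_open tU1 U1x.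
exists (fun k => U2 k /\ V1 (inv k)), V2; split.
  by apply: openI => //; exact: inv_continuous.
by do 3!split=> //; move=> k' x' [? ?] ?; apply: UV1 => //; apply: UV2.
Qed.

Lemma mul_continuous a : continuous tau tau (mul a).
Proof.
move=> W tW; apply: open_local => // x /(mul_open tW) [U [V [_ [tV [Ua [Vx UVW]]]]]].
by exists V; do 2!split=> //; move=> y; apply: UVW.
Qed.

Lemma mulr_continuous a : continuous tau tau (fun x => mul x a).
Proof.
move=> W tW; apply: open_local => // x /(mul_open tW) [U [V [tU [_ [Ux [Va UVW]]]]]].
by exists U; do 2!split=> //; move=> y Uy; apply: UVW.
Qed.

Lemma conj_continuous k : continuous tau tau (conj k).
Proof.
move=> W tW; apply: open_local => // x /(conj_open tW) [U [V [_ [tV [Uk [Vx UVW]]]]]].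
by exists V; do 2!split=> //; move=> y; apply: UVW.
Qed.

Lemma comeagre_conj k (P : G -> Prop) :
  comeagre tau P -> comeagre tau (fun x => P (conj k x)).
Proof.
apply: (meagre_homeo (A := fun x => ~ P x) (conjK groupG k) (conjKV groupG k));
  exact: conj_continuous.
Qed.

Lemma comeagre_mul k (P : G -> Prop) :
  comeagre tau P -> comeagre tau (fun x => P (mul k x)).
Proof.
apply: (meagre_homeo (A := fun x => ~ P x) (gmulK groupG k) (gmulKV groupG k));
  exact: mul_continuous.
Qed.

Lemma mul_inv_open W p : tau W -> W one ->
  exists U, tau U /\ U p /\ forall x y, U x -> U y -> W (mul x (inv y)).
Proof.
move=> tW; rewrite -(gmulxV groupG p) => /(mul_open tW) [U [V [tU [tV [Up [Vp UVW]]]]]].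
exists (fun x => U x /\ V (inv x)); split; first exact: openI (inv_continuous tV).
by split=> // x y [Ux _] [_ Vy]; apply: UVW.
Qed.

Lemma symmetric_square_root W : tau W -> W one ->
  exists V, tau V /\ V one /\ (forall x, V x -> V (inv x)) /\
    forall x y, V x -> V y -> W (mul x y).
Proof.
move=> tW W1; have [U [tU [U1 UW]]] := mul_inv_open one tW W1.
exists (fun x => U x /\ U (inv x)); split; first exact: openI (inv_continuous tU).
split; first by rewrite (ginv1 groupG).
split; first by move=> x [Ux Uix]; rewrite (ginvK groupG).
by move=> x y [Ux _] [_ Uy]; rewrite -(ginvK groupG y); apply: UW.
Qed.

End TopologicalGroup.

Lemma hom_continuous_of_at_one (G H : Type) (mulG : G -> G -> G) invG oneG tau
    (mulH : H -> H -> H) invH oneH sigma (phi : G -> H) :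
  topological_group mulG invG oneG tau -> topological_group mulH invH oneH sigma ->
  group_hom mulG mulH phi ->
  (forall W, sigma W -> W oneH -> exists U, tau U /\ U oneG /\ forall x, U x -> W (phi x)) ->
  continuous tau sigma phi.
Proof.
move=> topG topH phiM cont1 W sW; have [groupG [topo _]] := topG; have [groupH _] := topH.
apply: open_local => // x Wx.
have [|U [tU [U1 UW]]] := cont1 _ (mul_continuous topH (phi x) sW).
  by rewrite (gmulx1 groupH).
exists (fun y => U (mulG (invG x) y)); split; first exact: (mul_continuous topG).
split; first by rewrite (gmulV groupG).
by move=> y /UW; rewrite -phiM (gmulKV groupG).
Qed.

(** * Generic tuples and the conjugation tree *)

Section Topometric.

Variables (G : Type) (mul : G -> G -> G) (inv : G -> G) (one : G)
  (tau : (G -> Prop) -> Prop) (d : G -> G -> R).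
Hypotheses (topG : topological_group mul inv one tau)
  (metric_d : is_metric d) (biinv_d : bi_invariant mul d)
  (lsc_d : forall r, prod_open tau tau (fun p : G * G => ~ (d p.1 p.2 <= r))).

Variables (rho : G -> G -> R) (D : nat -> G).
Hypotheses (metric_rho : is_metric rho) (rho_complete : complete_metric rho)
  (tauE : forall U, tau U <-> metric_open rho U)
  (Ddense : forall U, tau U -> (exists x, U x) -> exists k, U (D k)).

Let groupG : is_group mul inv one := proj1 topG.
Let topo : is_topology tau := proj1 (proj2 topG).

Local Notation conj := (conj mul inv).

Lemma d_conj k x y : d (conj k x) (conj k y) = d x y.
Proof. by rewrite /conj (biinv_d (inv k) _ _).2 (biinv_d k _ _).1. Qed.

Lemma d_conjV k x y : d (conj (inv k) x) y = d x (conj k y).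
Proof. by rewrite -(d_conj k) (conjKV groupG). Qed.

Lemma d_open r x y : r < d x y ->
  exists U V, tau U /\ tau V /\ U x /\ V y /\ forall x' y', U x' -> V y' -> r < d x' y'.
Proof.
move=> lt; have [|U [V [tU [tV [Ux [Vy UV]]]]]] := @lsc_d r (x, y); first by move=> /=; lra.
by exists U, V; do 4!split=> //; move=> x' y' Ux' Vy'; have /= := UV (x', y') Ux' Vy'; lra.
Qed.

Lemma d_conj_open r k x y : r < d (conj k x) y ->
  exists U V, tau U /\ tau V /\ U k /\ V y /\ forall k' y', U k' -> V y' -> r < d (conj k' x) y'.
Proof.
move=> /d_open [U [V [tU [tV [Ux [Vy UV]]]]]].
have [U' [V' [tU' [_ [U'k [V'x UV']]]]]] := conj_open topG tU Ux.
by exists U', V; do 4!split=> //; move=> k' y' U'k' Vy'; apply: UV => //; apply: UV'.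
Qed.

(** Lower semi-continuity makes the bound a closed condition on the conjugator. *)
Lemma d_conj_limit u k x y r :
  converges rho u k -> (exists N, forall m, (N <= m)%N -> d (conj (u m) x) y <= r) ->
  d (conj k x) y <= r.
Proof.
move=> uk [N uN]; apply: Rnot_lt_le => /d_conj_open [U [V [tU [_ [Uk [Vy UV]]]]]].
have /tauE/(_ k Uk) [e [e0 Ue]] := tU; have [M uM] := uk e e0.
have := UV (u (maxn N M)) y (ltac:(apply: Ue; rewrite (metric_sym metric_rho); exact: uM (leq_maxr N M))) Vy.
by have := uN _ (leq_maxl N M); lra.
Qed.

(** One tuple serves every [e], whereas the tuple in [ample_generics] depends on it. *)
Definition conj_generic n (x : 'I_n -> G) : Prop :=
  forall e, 0 < e ->
    comeagre (@pow_open G n tau) (fun z => exists k, forall i, d (z i) (conj k (x i)) < e).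

(** A [z] in all the comeagre sets given by the [g j] is [half_pow j]-close to the orbit of [g j];
    by bi-invariance the two orbits are then uniformly close, and neighbourhoods of the orbit of [z]
    inherit comeagreness. *)
Lemma conj_generic_comeagre n :
  ample_generics mul inv tau d -> comeagre (@pow_open G n tau) (@conj_generic n).
Proof.
move=> ample.
have /choice_fun [g gP] j := ample n (half_pow j) (half_pow_gt0 j).
apply: comeagre_sub (comeagre_bigcap gP) => z zP e e0.
have [j jP] := half_pow_small (ltac:(lra) : 0 < e / 2).
have [_ [[k ->] zk]] := zP j.
apply: comeagre_sub (gP j) => w [_ [[l ->] wl]].
exists (mul l (inv k)) => i.
have lt1 := Rle_lt_trans _ _ _ (sup_metric_ge d w _ i) wl.
have lt2 := Rle_lt_trans _ _ _ (sup_metric_ge d z _ i) zk.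
rewrite (metric_sym metric_d) (conjM groupG).
have := metric_tri metric_d (w i) (conj l (g j i)) (conj l (conj (inv k) (z i))).
rewrite d_conj -[g j i in X in _ <= _ + X](conjK groupG k) d_conj.
rewrite (metric_sym metric_d (conj k (g j i))) (metric_sym metric_d _ (w i)).
by have := jP j (leqnn j); move: lt1 lt2; rewrite /diag_conj -/(conj l _) -/(conj k _); lra.
Qed.

(* [iter_generic m x]: a generic sequence of [m] further coordinates keeps [x] generic. *)
Fixpoint iter_generic m n (x : 'I_n -> G) : Prop :=
  if m is m'.+1 then comeagre tau (fun y => iter_generic m' (pcons y x)) else conj_generic x.

Definition super_generic n (x : 'I_n -> G) : Prop := forall m, iter_generic m x.

Hypothesis ample : ample_generics mul inv tau d.

Lemma iter_generic_comeagre m n : comeagre (@pow_open G n tau) (@iter_generic m n).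
Proof.
have [B [Bopen Bbase]] := polish_base topo metric_rho tauE Ddense.
elim: m n => [|m IH] n; first exact: conj_generic_comeagre.
exact: (kuratowski_ulam Bopen Bbase (IH n.+1)).
Qed.

Lemma super_generic_nil (x : 'I_0 -> G) :
  ~ meagre tau (fun _ => True) -> super_generic x.
Proof.
have [B [Bopen Bbase]] := polish_base topo metric_rho tauE Ddense.
move=> nG m; have [y] := comeagre_pow_nonempty Bopen Bbase nG (@iter_generic_comeagre m 0).
by rewrite (_ : y = x) //; apply: functional_extensionality => -[].
Qed.

Lemma super_generic_pcons n (x : 'I_n -> G) :
  super_generic x -> comeagre tau (fun y => super_generic (pcons y x)).
Proof. by move=> gx; apply: comeagre_bigcap => m; apply: (gx m.+1). Qed.

(** Some [u] close to the conjugate of [x] by [k] has comeagrely many [v] with [pcons v u] close to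
    a conjugate of [pcons y x] by some [f]. Then [mul (inv k) f] nearly fixes [x] and sends [y] near
    the conjugate of [v] by [inv k]. *)
Lemma almost_stabilizer_orbit n (x : 'I_n -> G) y e :
  ~ meagre tau (fun _ => True) -> super_generic x -> super_generic (pcons y x) -> 0 < e ->
  comeagre tau (fun v => exists f, (forall i, d (conj f (x i)) (x i) <= e) /\
                                   d (conj f y) v <= e).
Proof.
have [B [Bopen Bbase]] := polish_base topo metric_rho tauE Ddense.
move=> nG gx gyx e0; have e20 : 0 < e / 2 by lra.
have cP := kuratowski_ulam Bopen Bbase (gyx 0%N (e / 2) e20).
have [u [[k uk] uP]] := comeagre_pow_nonempty Bopen Bbase nG
  (comeagreI (gx 0%N (e / 2) e20) cP).
apply: comeagre_sub (comeagre_conj topG k uP) => v [f fP].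
exists (mul (inv k) f); split=> [i|].
  rewrite (conjM groupG) d_conjV; have := fP (lift ord0 i); rewrite !pconsS.
  have := metric_tri metric_d (conj f (x i)) (u i) (conj k (x i)).
  by have := uk i; rewrite (metric_sym metric_d _ (u i)); lra.
rewrite (conjM groupG) d_conjV (metric_sym metric_d).
by have := fP ord0; rewrite !pcons0; lra.
Qed.

Variables (A bad : G -> Prop).
Hypotheses (nonmeagreA : ~ meagre tau A)
  (bad_near_one : forall U, tau U -> U one -> exists g, U g /\ bad g).

Lemma nonmeagre_group : ~ meagre tau (fun _ => True).
Proof. by move=> mG; apply: nonmeagreA; apply: meagre_sub mG. Qed.

(* Effros-type step. The almost-stabilizer of [x] is cut into countably many
   closed pieces [piece c] with [f0 f1^-1 \in N] inside each. The orbits of [y] under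
   the pieces are analytic and cover a comeagre set, so one of them is comeagre
   near a generic [v], and there it meets both [A] and a translate of [A] by a bad [g]. *)
Lemma extension_step n (x : 'I_n -> G) (N : G -> Prop) e :
  super_generic x -> tau N -> N one -> 0 < e ->
  exists p : G * G * G * G, let: (y0, y1, f, g) := p in
    (super_generic (pcons y0 x) /\ super_generic (pcons y1 x)) /\
    (N f /\ (forall i, d (conj f (x i)) (x i) <= e) /\ d (conj f y1) y0 <= e) /\
    (bad g /\ A (mul (inv g) y0) /\ A y1).
Proof.
have [B [_ Bbase]] := polish_base topo metric_rho tauE Ddense.
move=> gx tN N1 e0; have e20 : 0 < e / 2 by lra.
have cT := super_generic_pcons gx; set T := fun y => _ in cT.
have [y [_ Ty]] := nonmeagre_meets_comeagre nonmeagreA cT.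
have cQ := almost_stabilizer_orbit nonmeagre_group gx Ty e20.
pose piece (c : nat * nat) z := rho (D c.1) z <= half_pow c.2.
pose good c := forall f0 f1, piece c f0 -> piece c f1 -> N (mul f0 (inv f1)).
pose F c f v := [/\ good c, piece c f, forall i, d (conj f (x i)) (x i) <= e / 2
                  & d (conj f y) v <= e / 2].
pose E c v := exists f, F c f v.
have piece_cover f : exists c, good c /\ piece c f.
  have [U [/tauE tU [/tU [r [r0 Ur]] UN]]] := mul_inv_open topG f tN N1.
  have [m mP] := half_pow_small (ltac:(lra) : 0 < r / 2).
  have [k kf] := dense_approx metric_rho tauE Ddense f (half_pow_gt0 m).
  exists (k, m); split; last by rewrite /piece /=; lra.
  have cU z : piece (k, m) z -> U z.
    rewrite /piece /= => kz; apply: Ur; have := metric_tri metric_rho f (D k) z.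
    by rewrite (metric_sym metric_rho f (D k)); have := mP m (leqnn m); lra.
  by move=> f0 f1 /cU Uf0 /cU Uf1; apply: UN.
have Fclosed c z v : ~ F c z v -> exists U V, tau U /\ tau V /\ U z /\ V v /\
     forall z' v', U z' -> V v' -> ~ F c z' v'.
  (* A failing clause of [F] fails on a whole box: [good c] does not involve the point, and the
     others are closed conditions. *)
  move=> nF; have tT := openT topo.
  case: (classic (good c)) => gc; last first.
    by exists (fun _ => True), (fun _ => True); do 4!split=> //; move=> z' v' _ _ [].
  case: (Rlt_or_le (half_pow c.2) (rho (D c.1) z)) => pz.
    exists (fun z => half_pow c.2 < rho (D c.1) z), (fun _ => True).
    split; last by do 3!split=> //; move=> z' v' lt _ [_]; rewrite /piece; lra.
    apply/tauE => t lt; exists (rho (D c.1) t - half_pow c.2); split; first lra.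
    move=> s st; have := metric_tri metric_rho (D c.1) s t.
    by rewrite (metric_sym metric_rho s t); lra.
  case: (classic (exists i, e / 2 < d (conj z (x i)) (x i))) => [[i lt]|ni].
    have [U [V [tU [_ [Uz [Vx UV]]]]]] := d_conj_open lt.
    exists U, (fun _ => True); do 4!split=> //; move=> z' v' Uz' _ [_ _ /(_ i) le _].
    by have := UV z' _ Uz' Vx; lra.
  have [|U [V [tU [tV [Uz [Vv UV]]]]]] := @d_conj_open (e / 2) z y v.
    apply: Rnot_le_lt => le; apply: nF; split=> // i.
    by apply: Rnot_lt_le => lt; apply: ni; exists i.
  exists U, V; do 4!split=> //; move=> z' v' Uz' Vv' [_ _ _ le].
  by have := UV z' v' Uz' Vv'; lra.
(* On [R], membership in [E c] and non-meagreness of [E c] at the point are equivalent, and both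
   hold on a neighbourhood within [R]. *)
pose R v := forall c, (E c v -> interior tau (nonmeagre_at tau (E c)) v) /\
                      (nonmeagre_at tau (E c) v -> E c v).
have cR : comeagre tau R.
  have m1 c := meagre_not_interior_nonmeagre_at Bbase (E c).
  have m2 c := nonmeagre_at_projection topo metric_rho rho_complete tauE Ddense (@Fclosed c).
  apply: (meagre_sub _ (meagre_bigcup_count (fun c => meagreU (m1 c) (m2 c)))).
  move=> v nR; apply: NNPP => nc; apply: nR => c.
  by split=> H; apply: NNPP => nH; apply: nc; exists c; [left | right].
have cA : comeagre tau (fun v => A v -> interior tau (nonmeagre_at tau A) v).
  apply: meagre_sub (meagre_not_interior_nonmeagre_at Bbase A) => v nI.
  by split=> [|Iv]; [apply: NNPP => nA|]; apply: nI.
have [v [Av [[[f [fx fy]] Rv] /(_ Av) Iv]]] :=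
  nonmeagre_meets_comeagre nonmeagreA (comeagreI (comeagreI cQ cR) cA).
have [c [gc pc]] := piece_cover f.
have Ecv : E c v by exists f; split.
pose W z := interior tau (nonmeagre_at tau A) z /\ interior tau (nonmeagre_at tau (E c)) z.
have tW : tau W by apply: openI => //; exact: interior_open.
have Wv : W v by split=> //; exact: (Rv c).1.
have nonmeagreW z U : nonmeagre_at tau A z -> tau U -> U z -> ~ meagre tau (fun t => A t /\ U t).
  by move=> Dz; apply: Dz.
have interior_sub P z : interior tau P z -> P z by move=> [U [_ [Uz]]]; apply.
have WE z : W z -> R z -> E c z by move=> [_ /interior_sub Dz] Rz; apply: (Rz c).2.
have cTR := comeagreI cT cR.
have [y1 [[Ay1 Wy1] [Ty1 Ry1]]] :=
  nonmeagre_meets_comeagre (nonmeagreW _ _ (interior_sub _ _ Iv) tW Wv) cTR.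
(* [g] is so near 1 that [A] is still nonmeagre at [mul (inv g) v]. Hence some [z] in [A] has
   [mul g z] generic and in [W], and this product serves as [y0]. *)
have [||g [/interior_sub Agv badg]] := bad_near_one
    (U := fun g => interior tau (nonmeagre_at tau A) (mul (inv g) v)).
- exact: (inv_continuous topG (mulr_continuous topG v (interior_open topo (nonmeagre_at tau A)))).
- by rewrite (ginv1 groupG) (gmul1 groupG).
have [|z [[Az Wz] [Tz Rz]]] :=
  nonmeagre_meets_comeagre (nonmeagreW _ _ Agv (mul_continuous topG g tW) _)
     (comeagre_mul topG g cTR).
  by rewrite (gmulKV groupG).
have [f1 [_ p1 f1x f1y]] := WE _ Wy1 Ry1; have [f0 [_ p0 f0x f0y]] := WE _ Wz Rz.
exists (mul g z, y1, mul f0 (inv f1), g); rewrite (gmulK groupG).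
split=> //; split=> //; split; first exact: gc.
(* Going back along [f1] and forward along [f0] costs [e / 2] twice, both for [y1] and for the
   entries of [x]. *)
have conj_f0f1 t t' : d (conj f1 t) t' <= e / 2 ->
    d (conj (mul f0 (inv f1)) t') (conj f0 t) <= e / 2.
  by rewrite (conjM groupG) d_conj d_conjV (metric_sym metric_d).
split=> [i|].
  have := metric_tri metric_d (conj (mul f0 (inv f1)) (x i)) (conj f0 (x i)) (x i).
  by have := f0x i; have := conj_f0f1 _ _ (f1x i); lra.
have := metric_tri metric_d (conj (mul f0 (inv f1)) y1) (conj f0 y) (mul g z).
by have := conj_f0f1 _ _ f1y; lra.
Qed.

(** The constant 3 counts the drift of the conjugates of [y0] along one branch, that of [y1] along
    the other, and their distance at the splitting node. *)
Lemma conj_tree e :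
  0 < e -> exists h : (nat -> bool) -> G, forall a b, a <> b ->
    exists g y0 y1, [/\ bad g, A (mul (inv g) y0), A y1
      & exists a' b', [/\ a' = a /\ b' = b \/ a' = b /\ b' = a
          & d (conj (h a') y0) (conj (h b') y1) <= 3 * e]].
Proof.
move=> e0.
pose x0 : 'I_0 -> G := fun i => match notF (ltn_ord i) with end.
(* Tuple lengths vary with the level, so nodes are packed as dependent pairs; off super-generic
   tuples the value is a dummy. *)
have /choice_fun [p pP] (s : {n & (('I_n -> G) * G)%type}) : exists p : G * G * G * G,
    super_generic (tagged s).1 ->
    let: (y0, y1, f, g) := p in let: (x, h) := tagged s in
    (super_generic (pcons y0 x) /\ super_generic (pcons y1 x)) /\
    (rho h (mul h f) < half_pow (tag s) /\
      (forall i, d (conj f (x i)) (x i) <= e * half_pow (tag s)) /\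
      d (conj f y1) y0 <= e * half_pow (tag s)) /\
    (bad g /\ A (mul (inv g) y0) /\ A y1).
  case: s => n [x h] /=; case: (classic (super_generic x)) => gx; last by exists (h, h, h, h).
  have hp := half_pow_gt0 n.
  (* No invariance of [rho] is assumed, so the neighbourhood of 1 for [f] depends on [h]. *)
  have [|||[[[y0 y1] f] g] P] := @extension_step n x
    (fun f => rho h (mul h f) < half_pow n) (e * half_pow n) gx.
  - by apply: (mul_continuous topG h (W := fun y => rho h y < half_pow n));
      apply/tauE/ball_open.
  - by rewrite (gmulx1 groupG) metric_refl.
  - exact: Rmult_lt_0_compat.
  by exists (y0, y1, f, g).
pose next n (s : ('I_n -> G) * G) := p (Tagged (fun n => (('I_n -> G) * G)%type) s).
pose node := fix node n (a : nat -> bool) : ('I_n -> G) * G :=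
  if n is m.+1 return ('I_n -> G) * G then
    let q := next m (node m a) in
    (pcons (if a m then q.1.1.2 else q.1.1.1) (node m a).1,
     if a m then mul (node m a).2 q.1.2 else (node m a).2)
  else (x0, one).
have node_ext n a b : (forall i, (i < n)%N -> a i = b i) -> node n a = node n b.
  elim: n => //= n IH ab; rewrite (IH (fun i lt => ab i (ltnW lt))).
  by rewrite (ab n (ltnSn n)).
have nextP n a : super_generic (node n a).1 ->
    let q := next n (node n a) in
    (super_generic (pcons q.1.1.1 (node n a).1) /\ super_generic (pcons q.1.1.2 (node n a).1)) /\
    (rho (node n a).2 (mul (node n a).2 q.1.2) < half_pow n /\
      (forall i, d (conj q.1.2 ((node n a).1 i)) ((node n a).1 i) <= e * half_pow n) /\
      d (conj q.1.2 q.1.1.2) q.1.1.1 <= e * half_pow n) /\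
    (bad q.2 /\ A (mul (inv q.2) q.1.1.1) /\ A q.1.1.2).
  rewrite /next; move: (pP (Tagged (fun n => (('I_n -> G) * G)%type) (node n a))) => /=.
  by case: (p _) => [[[y0 y1] f] g] /=; case: (node n a).
have node_generic n a : super_generic (node n a).1.
  elim: n => [|n /nextP IH] /=; first exact/super_generic_nil/nonmeagre_group.
  by case: (a n); apply IH.
have {}nextP n a := nextP n a (node_generic n a).
have /choice_fun [h hP] a : exists k, converges rho (fun n => (node n a).2) k.
  apply/rho_complete/half_pow_cauchy => // n /=; have [_ [[lt _] _]] := nextP n a.
  by case: (a n); [lra | rewrite metric_refl //; exact/Rlt_le/half_pow_gt0].
exists h => a b ab.
(* Once [y] is a coordinate of a node, later steps move its conjugate by a summable amount. *)
have stable n c y : (node n.+1 c).1 ord0 = y ->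
    d (conj (h c) y) (conj (node n.+1 c).2 y) <= e.
  move=> yE; apply: (d_conj_limit (hP c)); exists n.+1 => m nm.
  (* The term [2 * e * half_pow m] is the budget left for later steps: step [m] spends at most half
     of it. The index of [y] shifts at each level. *)
  suff [_] : (exists i, (node m c).1 i = y) /\
      d (conj (node m c).2 y) (conj (node n.+1 c).2 y) + 2 * e * half_pow m <=
      2 * e * half_pow n.+1.
    have := half_pow_le1 n; rewrite half_powS.
    have := Rmult_lt_0_compat _ _ e0 (half_pow_gt0 m); nra.
  elim: m nm => // m IH; rewrite ltnS leq_eqVlt => /orP [/eqP <-|/IH].
    by split; [exists ord0 | rewrite metric_refl //; lra].
  move=> [[i iy] le]; split; first by exists (lift ord0 i); rewrite /= pconsS.
  have := nextP m c; cbv zeta; have nodeS : (node m.+1 c).2 = if c m then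
    mul (node m c).2 (next m (node m c)).1.2 else (node m c).2 by [].
  rewrite nodeS half_powS; move=> [_ [[_ [/(_ i) + _]] _]]; rewrite iy => fi.
  have := Rmult_lt_0_compat _ _ e0 (half_pow_gt0 m).
  case: (c m); last by nra.
  have := metric_tri metric_d (conj (mul (node m c).2 (next m (node m c)).1.2) y)
    (conj (node m c).2 y) (conj (node n.+1 c).2 y).
  by rewrite (conjM groupG (node m c).2) d_conj; nra.
(* At the first disagreement one branch takes [y0] and the other [y1]; by symmetry it is [a] that
   takes [y0]. *)
wlog [n [abn [an bn]]] : a b ab / exists n, (forall i, (i < n)%N -> a i = b i) /\
    a n = false /\ b n = true.
  move=> wl; have [n abn lt] : exists2 n, a n != b n & forall i, (i < n)%N -> a i = b i.
    have ex : exists n, a n != b n.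
      apply: NNPP => nE; apply: ab; apply: functional_extensionality => n.
      by apply/eqP; apply: contraT => abn; case: nE; exists n.
    case: (ex_minnP ex) => n abn nmin; exists n => // i lt; apply/eqP; apply: contraT => /nmin.
    by rewrite leqNgt lt.
  case an: (a n) abn; case bn: (b n) => // _; last by apply: wl => //; exists n.
  have [||g [y0 [y1 [bg Ay0 Ay1 [a' [b' [ab' le]]]]]]] := wl b a.
  - by move=> ba; apply: ab.
  - by exists n; split=> // i /lt.
  by exists g, y0, y1; split=> //; exists a', b'; split=> //; tauto.
have [_ [[_ [_ fy]] [bg [Ay0 Ay1]]]] := nextP n a.
exists (next n (node n a)).2, (next n (node n a)).1.1.1, (next n (node n a)).1.1.2.
split=> //; exists a, b; split; first by left.
have sa := @stable n a (next n (node n a)).1.1.1.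
have sb := @stable n b (next n (node n a)).1.1.2.
move: sa sb; rewrite /= !pcons0 an bn -(node_ext n a b abn) => /(_ erefl) sa /(_ erefl) sb.
move: sb; rewrite (conjM groupG) (metric_sym metric_d) => sb.
have le1 := half_pow_le1 n.
set h0 := (node n a).2 in sa sb; set y0 := (next n (node n a)).1.1.1 in sa fy *.
set y1 := (next n (node n a)).1.1.2 in sb fy *; set f := (next n (node n a)).1.2 in sb fy.
have := metric_tri metric_d (conj (h a) y0) (conj h0 y0) (conj (h b) y1).
have := metric_tri metric_d (conj h0 y0) (conj h0 (conj f y1)) (conj (h b) y1).
by rewrite d_conj (metric_sym metric_d y0); nra.
Qed.

End Topometric.

(** * Mycielski's theorem and small covers *)

Section Mycielski.

Variables (G : Type) (mul : G -> G -> G) (inv : G -> G) (one : G)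
  (tau : (G -> Prop) -> Prop) (rho : G -> G -> R).
Hypotheses (topG : topological_group mul inv one tau)
  (metric_rho : is_metric rho) (rho_complete : complete_metric rho)
  (tauE : forall U, tau U <-> metric_open rho U).

Let groupG : is_group mul inv one := proj1 topG.
Let topo : is_topology tau := proj1 (proj2 topG).

Definition open_family (I : Type) (U : I -> G -> Prop) : Prop :=
  forall i, tau (U i) /\ exists x, U i x.

(** [N] is not dense in the nonempty open translate of [V] by [inv x0], so some quotient has a
    neighbourhood missing [N]; continuity spreads this to open sets. *)
Lemma avoid_pair (U V N : G -> Prop) :
  nowhere_dense tau N -> tau U -> (exists x, U x) -> tau V -> (exists y, V y) ->
  exists U' V', (tau U' /\ exists x, U' x) /\ (tau V' /\ exists y, V' y) /\
    (forall x, U' x -> U x) /\ (forall y, V' y -> V y) /\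
    forall x y, U' x -> V' y -> ~ N (mul (inv x) y).
Proof.
move=> nN tU [x0 Ux0] tV [y0 Vy0].
have [z [Vz ncl]] : exists z, V (mul x0 z) /\ ~ closure tau N z.
  apply: NNPP => nE; apply: (nN (mul (inv x0) y0)).
  exists (fun z => V (mul x0 z)); split; first exact: (mul_continuous topG).
  split; first by rewrite (gmulKV groupG).
  by move=> z Vz; apply: NNPP => ncl; apply: nE; exists z.
have [W [tW [Wz WN]]] : exists W, tau W /\ W z /\ forall t, W t -> ~ N t.
  apply: NNPP => nE; apply: ncl => W tW Wz; apply: NNPP => nW; apply: nE.
  by exists W; do 2!split=> //; move=> t Wt Nt; apply: nW; exists t.
rewrite -(gmulK groupG x0 z) in Wz.
have [U1 [V1 [tU1 [tV1 [U1x [V1y UV1]]]]]] := mul_open topG tW Wz.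
exists (fun x => U x /\ U1 (inv x)), (fun y => V y /\ V1 y).
split; first by split; [apply: openI (inv_continuous topG tU1) | exists x0].
split; first by split; [apply: openI | exists (mul x0 z)].
by do 2!(split; first by move=> ? []); move=> x y [_ ?] [_ ?]; apply: WN; apply: UV1.
Qed.

(** The pairs in [L] are treated one at a time; shrinking preserves what was already avoided. *)
Lemma avoid_pairs (I : eqType) (N : nat -> G -> Prop) (L : seq (nat * I * I)) (U : I -> G -> Prop) :
  (forall k, nowhere_dense tau (N k)) -> open_family U ->
  exists U', open_family U' /\ (forall i x, U' i x -> U i x) /\
    forall k i j, (k, i, j) \in L -> i != j ->
      forall x y, U' i x -> U' j y -> ~ N k (mul (inv x) y).
Proof.
move=> nN oU; elim: L => [|[[k i] j] L [U1 [oU1 [U1U avoid]]]]; first by exists U.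
case: (eqVneq i j) => [eij|nij].
  exists U1; do 2!split=> //; move=> k' i' j'; rewrite inE => /orP [/eqP [_ -> ->]|/avoid //].
  by rewrite eij eqxx.
have [V [W [oV [oW [VU [WU VW]]]]]] :=
  avoid_pair (nN k) (oU1 i).1 (oU1 i).2 (oU1 j).1 (oU1 j).2.
pose U' l := if l == i then V else if l == j then W else U1 l.
have U'U1 l x : U' l x -> U1 l x.
  by rewrite /U'; case: eqP => [->|_]; [exact: VU|case: eqP => [->|_ //]; exact: WU].
exists U'; split; first by move=> l; rewrite /U'; do 2!case: ifP => _ //.
split; first by move=> l x /U'U1/U1U.
move=> k' i' j'; rewrite inE => /orP [/eqP [-> -> ->] _ x y|inL ne x y /U'U1 Ux /U'U1 Uy].
  by rewrite /U' !eqxx eq_sym (negbTE nij); apply: VW.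
exact: avoid inL ne _ _ Ux Uy.
Qed.

Lemma shrink (U : G -> Prop) e : 0 < e -> tau U -> (exists x, U x) ->
  exists V, (tau V /\ exists x, V x) /\
    exists p r, r <= e /\ (forall x, V x -> rho p x <= r) /\ forall x, rho p x <= r -> U x.
Proof.
move=> e0 tU [x Ux]; have /tauE/(_ x Ux) [r [r0 rU]] := tU.
exists (fun y => rho x y < Rmin e (r / 2)); split.
  split; first exact/tauE/ball_open.
  by exists x; rewrite metric_refl //; apply: Rmin_pos => //; lra.
exists x, (Rmin e (r / 2)); split; first exact: Rmin_l.
split=> y xy; first lra.
by apply: rU; have := Rmin_r e (r / 2); lra.
Qed.

(* Node [s] of level [n] sits below node [behead s] of level [n.-1]: words are read backwards. *)
Lemma next_level (N : nat -> G -> Prop) n (U : seq bool -> G -> Prop) :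
  (forall k, nowhere_dense tau (N k)) -> open_family U ->
  exists U', open_family U' /\
    (forall s, exists p r, r <= half_pow n /\ (forall x, U' s x -> rho p x <= r) /\
                           forall x, rho p x <= r -> U (behead s) x) /\
    forall k s t, (k <= n)%N -> size s = n.+1 -> size t = n.+1 -> s != t ->
      forall x y, U' s x -> U' t y -> ~ N k (mul (inv x) y).
Proof.
move=> nN oU.
have /choice_fun [V VP] s := shrink (half_pow_gt0 n) (oU (behead s)).1 (oU (behead s)).2.
(* Finitely many tasks: each [k] up to [n] with each pair of words of length [n.+1]. *)
pose L := [seq (val u.1.1, val u.1.2, val u.2) |
            u <- enum {: 'I_n.+1 * n.+1.-tuple bool * n.+1.-tuple bool}].
have [U' [oU' [U'V avoid]]] := avoid_pairs L nN (fun s => (VP s).1).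
exists U'; split=> //; split.
  move=> s; have [_ [p [r [rn [Vr rU]]]]] := VP s.
  by exists p, r; do 2!split=> //; move=> x /U'V/Vr.
move=> k s t kn ss st; apply: avoid.
apply/mapP; exists (Ordinal (kn : (k < n.+1)%N), Tuple (introT eqP ss), Tuple (introT eqP st)) => //.
by rewrite mem_enum.
Qed.

Lemma mycielski (M : G -> Prop) : meagre tau M ->
  exists h : (nat -> bool) -> G, forall a b, a <> b -> ~ M (mul (inv (h a)) (h b)).
Proof.
move=> [N [nN MN]].
have /choice_fun [next nextP] (q : nat * (seq bool -> G -> Prop)) :
    exists U', open_family q.2 -> _ :=
  match classic (open_family q.2) with
  | or_introl oU => let: ex_intro U' P := next_level q.1 nN oU in ex_intro _ U' (fun _ => P)
  | or_intror nU => ex_intro _ q.2 (fun oU => False_ind _ (nU oU))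
  end.
pose level := fix level n := if n is m.+1 then next (m, level m) else fun _ _ => True.
have levelP n : open_family (level n).
  elim: n => [s|n IH]; last exact: (nextP (n, level n) IH).1.
  by split; [exact: openT | exists one].
pose word := fix word n (a : nat -> bool) := if n is m.+1 then a m :: word m a else [::].
have size_word n a : size (word n a) = n by elim: n => //= n ->.
have /choice_fun [h hP] a : exists x, forall n, level n (word n a) x.
  apply: (nested_balls metric_rho rho_complete) => n; first exact: (levelP n _).2.
  exact: (nextP (n, level n) (levelP n)).2.1 (word n.+1 a).
exists h => a b ab /MN [k Nk].
have [n abn] : exists n, a n != b n.
  apply: NNPP => nE; apply: ab; apply: functional_extensionality => n.
  by apply/eqP; apply: contraT => abn; case: nE; exists n.
have ne m : (n < m)%N -> word m a != word m b.
  elim: m => // m IH; rewrite ltnS leq_eqVlt /= eqseq_cons negb_and => /orP [/eqP <-|/IH ->].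
    by rewrite abn.
  by rewrite orbT.
(* Level [m.+1] avoids [N k] as [k <= m], and its words already separate [a] and [b] as [n <= m]. *)
pose m := maxn k n; have [_ [_ avoid]] := nextP (m, level m) (levelP m).
apply: (avoid k (word m.+1 a) (word m.+1 b) (leq_maxl k n) _ _ _ _ _ (hP a m.+1) (hP b m.+1) Nk).
- exact: (size_word m.+1 a).
- exact: (size_word m.+1 b).
- by apply: ne; rewrite ltnS leq_maxr.
Qed.

End Mycielski.

(** If distinct [h a] always fell in distinct translates, the Cantor space would inject into [S].
    Two points of one translate of [V] have their quotient in the product of [inv V] and [V]. *)
Lemma souslin_pigeonhole (H : Type) (mul : H -> H -> H) inv one sigma (W : H -> Prop)
    (h : (nat -> bool) -> H) :
  topological_group mul inv one sigma -> usouslin_lt_continuum mul one sigma ->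
  sigma W -> W one -> exists a b, a <> b /\ W (mul (inv (h a)) (h b)).
Proof.
move=> topH [S [[_ nS] cov]] sW W1; have [groupH _] := topH.
have [V [sV [V1 [Vinv VW]]]] := symmetric_square_root topH sW W1.
have [A [covA [[f [fS finj]] _]]] := cov V (ltac:(by exists V)).
have /choice_fun [c cP] a := covA (h a).
have [a [b [ab cab]]] : exists a b, a <> b /\ c a = c b.
  apply: NNPP => inj; apply: nS; exists (fun a => f (c a)); split=> [a _|a b _ _].
    by apply: fS; have [v []] := cP a.
  have [va [Aa _]] := cP a; have [vb [Ab _]] := cP b => /(finj _ _ Aa Ab) cab.
  by apply: NNPP => ab; apply: inj; exists a, b.
exists a, b; split=> //; have [v [_ [Vv ->]]] := cP a; have [w [_ [Vw ->]]] := cP b.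
rewrite cab (ginvM groupH) -(gmulA groupH) (gmulK groupH).
by apply: VW => //; apply: Vinv.
Qed.

(** * Continuity of the homomorphism *)

Theorem theorem4p7
  (G : Type) (mulG : G -> G -> G) (invG : G -> G) (oneG : G)
  (tau : (G -> Prop) -> Prop) (dG : G -> G -> R)
  (H : Type) (mulH : H -> H -> H) (invH : H -> H) (oneH : H)
  (sigma : (H -> Prop) -> Prop)
  (phi : G -> H) :
  polish_topometric_group mulG invG oneG tau dG ->
  ample_generics mulG invG tau dG ->
  topological_group mulH invH oneH sigma ->
  usouslin_lt_continuum mulH oneH sigma ->
  group_hom mulG mulH phi ->
  continuous (metric_open dG) sigma phi ->
  continuous tau sigma phi.
Proof.
move=> [[_ [metric_d [_ lsc_d]]] [[topG [_ [[D Ddense] [rho [metric_rho [rho_complete tauE]]]]]] biinv_d]].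
move=> ample topH souslin phiM phi_d.
have [groupG [topo _]] := topG; have [groupH _] := topH.
have phi1 : phi oneG = oneH.
  by rewrite -(gmulK groupH (phi oneG) (phi oneG)) -phiM (gmul1 groupG) (gmulV groupH).
have phiV x : phi (invG x) = invH (phi x).
  by apply: (ginv_unique groupH); rewrite -phiM (gmulxV groupG).
apply: (hom_continuous_of_at_one topG topH phiM) => W sW W1.
apply: NNPP => ncont.
(* Three square roots allow products of up to eight factors from [V]; five are used. *)
have [V1 [sV1 [V11 [_ V1W]]]] := symmetric_square_root topH sW W1.
have [V2 [sV2 [V21 [_ V2V1]]]] := symmetric_square_root topH sV1 V11.
have [V [sV [V_1 [Vinv VV2]]]] := symmetric_square_root topH sV2 V21.
have [r [r0 rV]] : exists r, 0 < r /\ forall x, dG oneG x < r -> V (phi x).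
  by apply: (phi_d V sV); rewrite phi1.
have nonmeagreV : ~ meagre tau (fun x => V (phi x)).
  move=> /(mycielski topG metric_rho rho_complete tauE) [h hP].
  have [a [b [/hP nV]]] := souslin_pigeonhole (fun a => phi (h a)) topH souslin sV V_1.
  by rewrite -phiV -phiM.
have bad_near U : tau U -> U oneG -> exists g, U g /\ ~ W (phi g).
  move=> tU U1; apply: NNPP => nE; apply: ncont; exists U; do 2!split=> //.
  by move=> x Ux; apply: NNPP => nW; apply: nE; exists x.
(* The tree bound [3 * (r / 4)] is below [r]. *)
have e0 : 0 < r / 4 by lra.
have [h hP] := conj_tree topG metric_d biinv_d lsc_d metric_rho rho_complete tauE Ddense ample
  nonmeagreV bad_near e0.
have [a [b [ab Vab]]] := souslin_pigeonhole (fun a => phi (h a)) topH souslin sV V_1.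
have [g [y0 [y1 [nWg Vg Vy1 [a' [b' [ab' le]]]]]]] := hP a b ab; apply: nWg.
(* By [le] and invariance, conjugation by [x] takes [y1] within [r] of [y0]. *)
set x := mulG (invG (h a')) (h b').
have Vx : V (phi x).
  rewrite /x phiM phiV; case: ab' => -[-> ->] //.
  by rewrite -[phi (h a)](ginvK groupH) -(ginvM groupH); apply: Vinv.
have Vdiff : V (phi (mulG y0 (invG (conj mulG invG x y1)))).
  apply: rV; rewrite -((biinv_d (conj mulG invG x y1) _ _).2) (gmul1 groupG).
  rewrite -(gmulA groupG) (gmulV groupG) (gmulx1 groupG) /x (conjM groupG).
  by rewrite (d_conjV topG biinv_d) (metric_sym metric_d); lra.
(* Five factors with image in [V]: the [dG]-small quotient, [x], [y1], the inverse of [x], and the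
   inverse of [mulG (invG g) y0]. *)
have -> : g = mulG (mulG (mulG (mulG y0 (invG (conj mulG invG x y1))) x)
                      (mulG y1 (invG x))) (invG (mulG (invG g) y0)).
  have conjE : mulG x (mulG y1 (invG x)) = conj mulG invG x y1 by rewrite /conj (gmulA groupG).
  rewrite -[mulG (mulG _ x) _](gmulA groupG) conjE -[mulG (mulG y0 _) _](gmulA groupG).
  by rewrite (gmulV groupG) (gmulx1 groupG) (ginvM groupG) (ginvK groupG) (gmulKV groupG).
have V_V1 z : V z -> V1 z.
  by move=> Vz; rewrite -(gmulx1 groupH z) -(gmulx1 groupH (mulH z _)); apply: V2V1 => //; apply: VV2.
rewrite phiM; apply: V1W; last by apply: V_V1; rewrite phiV; apply: Vinv.
rewrite phiM; apply: V2V1; rewrite phiM; apply: VV2 => //.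
by rewrite phiV; apply: Vinv.
Qed.
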